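(* Let $k\ge 1$ be an integer. A $k$-SAT formula is satisfiable if no variable appears in more than $\frac{2^k}{ek}$ clauses. Furthermore, for such a $k$-SAT formula with $n$ clauses, a uniformly random assignment satisfies the formula with probability at least $\exp\bigl(-e\,n\,2^{-k}\bigr)$.
   Context: A $k$-SAT formula is a Boolean formula in conjunctive normal form, i.e. a finite AND of clauses, each clause being an OR of exactly $k$ (distinct) literals, where a literal is a variable or its negation. A variable appears in a clause if it or its negation is one of the literals of the clause. An assignment gives each variable a value in $\{0,1\}$; a uniformly random assignment sets each variable independently to $0$ or $1$ with probability $\tfrac12$ each. $e$ is the base of the natural logarithm. *)

(* Defs.v *)
From mathcomp Require Import all_boot all_order all_algebra.
From mathcomp Require Import reals.

Set Implicit Arguments.
Unset Strict Implicit.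
Unset Printing Implicit Defensive.

Import Order.TTheory GRing.Theory Num.Theory.
Local Open Scope ring_scope.

(* The literal (v, true) is the variable v, and (v, false) is its negation. *)
Definition literal (V : finType) : finType := (V * bool)%type.

(* A clause is a set of literals, so that its literals are distinct; it may
   contain both a variable and its negation. *)
Definition clause (V : finType) : finType := {set literal V}.

(* A conjunction is a sequence of clauses: a repeated clause is counted with
   its multiplicity, both in the number of clauses and in [occurrences]. *)
Definition cnf (V : finType) : Type := seq (clause V).

Definition is_ksat (V : finType) (k : nat) (F : cnf V) : bool :=
  all (fun C : clause V => #|C| == k) F.

Definition assignment (V : finType) : finType := {ffun V -> bool}.

Definition sat_literal (V : finType) (a : assignment V) (l : literal V) : bool :=
  a l.1 == l.2.

Definition sat_clause (V : finType) (a : assignment V) (C : clause V) : bool :=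
  [exists l in C, sat_literal a l].

Definition sat_cnf (V : finType) (a : assignment V) (F : cnf V) : bool :=
  all (sat_clause a) F.

Definition satisfiable (V : finType) (F : cnf V) : Prop :=
  exists a : assignment V, sat_cnf a F.

Definition appears (V : finType) (v : V) (C : clause V) : bool :=
  ((v, true) \in C) || ((v, false) \in C).

Definition occurrences (V : finType) (F : cnf V) (v : V) : nat :=
  count (appears v) F.

(* Law of an assignment whose values are independent fair bits: each
   assignment has weight \prod_v 1/2. *)
Definition Pr_uniform (R : realType) (V : finType) (E : pred (assignment V)) : R :=
  \sum_(a : assignment V | E a) \prod_(v : V) (2^-1 : R).

(* Main.v *)
(** Lovász local lemma with the uniform weight [x = 1 - exp (- e 2^-k)] on the
    events "clause [i] is violated".  A clause shares a variable with at most
    [D <= 2^k / e] clauses, itself included, so the hypothesis of the local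
    lemma is [2^-k <= x (1 - x)^(D - 1)]; it follows from [exp t - 1 >= t] at
    [t = e 2^-k], and [(1 - x)^n] is exactly the claimed lower bound. *)
Require Import Defs.
From mathcomp Require Import all_boot all_order all_algebra.
From mathcomp Require Import reals sequences exp.
From mathcomp Require Import ring lra.

Set Implicit Arguments.
Unset Strict Implicit.

Import Order.TTheory GRing.Theory Num.Theory.
Local Open Scope ring_scope.

(** * The lopsided local lemma, by counting outcomes *)

Definition avoid (T I : finType) (bad : I -> {set T}) (S : {set I}) : {set T} :=
  [set a | [forall i in S, a \notin bad i]].

Lemma avoid_subset (T I : finType) (bad : I -> {set T}) (S S' : {set I}) :
  S \subset S' -> avoid bad S' \subset avoid bad S.
Proof.
move=> /subsetP sSS'; apply/subsetP => a; rewrite !inE => /forall_inP h.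
by apply/forall_inP => i /sSS'; exact: h.
Qed.

Lemma card_avoidU1 (R : numDomainType) (T I : finType) (bad : I -> {set T})
    (S : {set I}) (i : I) :
  #|avoid bad (i |: S)|%:R
    = #|avoid bad S|%:R - #|bad i :&: avoid bad S|%:R :> R.
Proof.
have -> : avoid bad (i |: S) = avoid bad S :\: bad i.
  apply/setP => a; rewrite !inE; apply/forall_inP/andP => [h|[h1 /forall_inP h2] j].
    split; first by apply: h; rewrite setU11.
    by apply/forall_inP => j jS; apply: h; rewrite setU1r.
  by rewrite in_setU1 => /predU1P[->|/h2].
by rewrite -(cardsID (bad i) (avoid bad S)) natrD setIC addrAC subrr add0r.
Qed.

(* Lopsided form: negative correlation with the non-neighbours is enough. *)
Lemma lopsided_local_lemma (R : realDomainType) (T I : finType)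
    (bad : I -> {set T}) (N : I -> {set I}) (x : I -> R)
    (x01 : forall i, 0 <= x i <= 1)
    (hbad : forall (i : I) (S : {set I}), i \notin S -> [disjoint S & N i] ->
      #|bad i :&: avoid bad S|%:R
        <= x i * \prod_(j in N i) (1 - x j) * #|avoid bad S|%:R) :
  (\prod_i (1 - x i)) * #|T|%:R <= #|avoid bad setT|%:R.
Proof.
have x'ge0 i : 0 <= 1 - x i by have /andP[] := x01 i; rewrite subr_ge0.
have x'le1 i : 1 - x i <= 1 by have /andP[] := x01 i; rewrite gerBl.
(* This is the conditional bound $P(\text{bad}_i \mid \text{avoid } S) \le x_i$, multiplied out so
   that an empty [avoid bad S] needs no separate treatment. *)
pose bound i (S : {set I}) := #|bad i :&: avoid bad S|%:R <= x i * #|avoid bad S|%:R.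
(* The elements of [S1] are added to [S2] one at a time. Adding [i] keeps at least a fraction
   [1 - x i] of the outcomes, by [bound] for a set of size below [m]. *)
have chain m : (forall i (S : {set I}), i \notin S -> (#|S| < m)%N -> bound i S) ->
    forall S1 S2 : {set I}, [disjoint S1 & S2] -> (#|S1 :|: S2| <= m)%N ->
    (\prod_(j in S1) (1 - x j)) * #|avoid bad S2|%:R
      <= #|avoid bad (S1 :|: S2)|%:R.
  move=> IH S1; have [n] := ubnP #|S1|.
  elim: n S1 => // n IHn S1; rewrite ltnS => leS1 S2 dis leU.
  have [->|[i iS1]] := set_0Vmem S1; first by rewrite big_set0 mul1r set0U.
  have eU : S1 :|: S2 = i |: ((S1 :\ i) :|: S2) by rewrite setUA setD1K.
  have iS2 : i \notin S2 by rewrite (disjointFr dis iS1).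
  have iU : i \notin (S1 :\ i) :|: S2 by rewrite !inE eqxx.
  have ltU : (#|(S1 :\ i) :|: S2| < m)%N.
    by apply: leq_trans leU; rewrite eU cardsU1 iU.
  have := IHn (S1 :\ i) _ S2 _ (ltnW ltU).
  rewrite (cardsD1 i) iS1 in leS1.
  have sD : [disjoint S1 :\ i & S2].
    by apply: disjointWl dis; rewrite subsetDl.
  move=> /(_ leS1 sD) {}IHn.
  rewrite eU card_avoidU1 (big_setD1 i) //= -mulrA.
  apply: (@le_trans _ _ ((1 - x i) * #|avoid bad ((S1 :\ i) :|: S2)|%:R)).
    exact: ler_wpM2l.
  by rewrite mulrBl mul1r lerD2l lerN2; exact: IH.
(* Strong induction on [#|S|]: dropping the constraints from [N i] only enlarges the left side, so
   [hbad] applies to [S :\: N i]; [chain] then restores the constraints of [S :&: N i]. *)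
have all_bound m i (S : {set I}) : i \notin S -> (#|S| < m)%N -> bound i S.
  elim: m i S => // m IH i S iS; rewrite ltnS => leS.
  have iD : i \notin S :\: N i by rewrite inE (negPf iS) andbF.
  have dis : [disjoint S :\: N i & N i].
    by rewrite -setI_eq0 setDE -setIA setICA setIC -setIA setICr !setI0.
  have x0 : 0 <= x i by have /andP[] := x01 i.
  apply: (@le_trans _ _ #|bad i :&: avoid bad (S :\: N i)|%:R).
    by rewrite ler_nat subset_leq_card // setIS // avoid_subset // subsetDl.
  apply: (le_trans (hbad _ _ iD dis)); rewrite -mulrA ler_wpM2l //.
  have dI : [disjoint S :&: N i & S :\: N i].
    by rewrite -setI_eq0 setDE -setIA [N i :&: _]setICA setICr !setI0.
  have := chain m IH _ _ dI; rewrite setID => /(_ leS); apply: le_trans.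
  (* The neighbours of [i] outside [S] contribute factors at most 1. *)
  rewrite ler_wpM2r ?ler0n // (big_setID S) /= setIC.
  by rewrite ler_piMr ?prodr_ge0 // prodr_ile1 // => j _; rewrite x'ge0 x'le1.
have := chain #|I| _ [set: I] set0; rewrite setU0 cardsT leqnn.
have -> : avoid bad set0 = setT.
  by apply/setP => a; rewrite !inE; apply/forall_inP => i; rewrite inE.
rewrite cardsT (eq_bigl predT) => [|i]; last by rewrite inE.
apply=> //; first by move=> i S iS _; exact: (all_bound #|S|.+1).
by rewrite -setI_eq0 setI0.
Qed.

(** * Variables of violated clauses, and independence *)

Definition clause_vars (V : finType) (C : clause V) : {set V} :=
  [set v | appears v C].

Lemma mem_clause_vars (V : finType) (C : clause V) (l : literal V) :
  l \in C -> l.1 \in clause_vars C.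
Proof. by case: l => v []; rewrite inE /appears => -> //; rewrite orbT. Qed.

Lemma clause_varsE (V : finType) (C : clause V) :
  clause_vars C = [set l.1 | l in C].
Proof.
apply/setP => v; apply/idP/imsetP => [|[l lC ->]]; last exact: mem_clause_vars.
by rewrite inE => /orP[] ?; [exists (v, true) | exists (v, false)].
Qed.

Lemma sat_clausePn (V : finType) (a : assignment V) (C : clause V) :
  reflect (forall l, l \in C -> a l.1 = ~~ l.2) (~~ sat_clause a C).
Proof.
rewrite negb_exists_in; apply: (iffP forall_inP) => h l /h;
  by rewrite /sat_literal; case: (a _) l.2 => [] [].
Qed.

(** In a violated clause every literal is false, so two literals on the same variable have the same
    sign and coincide. A clause with a variable and its negation is always satisfied, hence
    excluded. *)
Lemma card_clause_vars_unsat (V : finType) (a : assignment V) (C : clause V) :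
  ~~ sat_clause a C -> #|clause_vars C| = #|C|.
Proof.
move=> /sat_clausePn aC; rewrite clause_varsE card_in_imset // => l m lC mC e1.
apply/eqP; rewrite -pair_eqE /= e1 eqxx /=.
by rewrite -[l.2]negbK -[m.2]negbK -!aC // e1.
Qed.

Lemma eq_sat_clause (V : finType) (a b : assignment V) (C : clause V) :
  {in clause_vars C, a =1 b} -> sat_clause a C = sat_clause b C.
Proof.
move=> ab; apply: eq_existsb => l; case lC: (l \in C) => //=.
by rewrite /sat_literal ab ?mem_clause_vars.
Qed.

(* The flips of the violating assignments of [G] on subsets of the variables of
   [C] are pairwise distinct, since [C] determines a violating assignment on
   its variables. *)
Lemma card_unsat_indep (V : finType) (C : clause V) (G : {set assignment V})
    (indepG : forall a b : assignment V,
      {in ~: clause_vars C, a =1 b} -> a \in G -> b \in G) :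
  (#|[set a : assignment V | ~~ sat_clause a C] :&: G| * 2 ^ #|C| <= #|G|)%N.
Proof.
set B := [set a : assignment V | _].
(* Any violating assignment certifies that [C] has [#|C|] distinct variables, so that $2^{|C|}$
   counts the sets of variables to flip. *)
have [->|[a0]] := set_0Vmem (B :&: G); first by rewrite cards0 mul0n.
rewrite !inE => /andP[/card_clause_vars_unsat eC _].
rewrite -eC -card_powerset -cardsX.
pose flip (aW : assignment V * {set V}) : assignment V :=
  [ffun v => aW.1 v (+) (v \in aW.2)].
have flipN a (W : {set V}) v : W \subset clause_vars C ->
    v \notin clause_vars C -> flip (a, W) v = a v.
  move=> /subsetP sW vC; rewrite ffunE /=.
  by rewrite (contraNF (sW v) vC) addbF.
have flip_inj : {in setX (B :&: G) (powerset (clause_vars C)) &, injective flip}.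
  move=> [a W] [b W'].
  rewrite !inE /= => /andP[/andP[/sat_clausePn aC _] sW].
  move=> /andP[/andP[/sat_clausePn bC _] sW'] efl.
  have eab : a = b.
    apply/ffunP => v; have [|vC] := boolP (v \in clause_vars C).
      by rewrite clause_varsE => /imsetP[l lC ->]; rewrite aC ?bC.
    by have := congr1 (fun f : assignment V => f v) efl; rewrite !flipN.
  congr (_, _) => //; apply/setP => v.
  have := congr1 (fun f : assignment V => f v) efl.
  by rewrite !ffunE /= eab => /addbI.
rewrite -(card_in_imset flip_inj); apply/subset_leq_card/subsetP.
move=> _ /imsetP[[a W] aW ->]; move: aW; rewrite !inE /=.
move=> /andP[/andP[_ aG] sW].
by apply: indepG aG => v; rewrite inE => vC; rewrite flipN.
Qed.

(** * Neighbour count and numerical condition *)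

(** Union bound: a clause meeting [A] is counted at least once on the right, at a shared
    variable. *)
Lemma card_meeting_clauses_le (V : finType) (F : cnf V) (A : {set V}) :
  (#|[set j : 'I_(size F) | ~~ [disjoint A & clause_vars (tnth (in_tuple F) j)]]|
     <= \sum_(v in A) occurrences F v)%N.
Proof.
pose occ v := [set j : 'I_(size F) | appears v (tnth (in_tuple F) j)].
have -> : (\sum_(v in A) occurrences F v = \sum_(v in A) #|occ v|)%N.
  apply: eq_bigr => v _; rewrite /occurrences -sum1_count big_tnth -sum1_card.
  by apply: eq_bigl => j; rewrite inE.
apply: (@leq_trans #|\bigcup_(v in A) occ v|).
  apply/subset_leq_card/subsetP => j; rewrite inE => /pred0Pn[v /andP[/= vA]].
  by rewrite inE => vj; apply/bigcupP; exists v => //; rewrite inE.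
apply: (big_ind2 (fun (X : {set _}) n => #|X| <= n)%N) => [|X m Y n hX hY|//].
  by rewrite cards0.
by apply: leq_trans (leq_add hX hY); rewrite cardsU leq_subr.
Qed.

(** Here [d] is the number of neighbours other than the clause itself. With $t = ep$, [hd] gives $td
    \le 1 - t$, so the right side is at least $(1 - e^{-t})e^{t-1} = (e^t - 1)/e \ge t/e = p$. *)
Lemma local_lemma_weight (R : realType) (p : R) (d : nat) :
  0 < p -> d.+1%:R <= (expR 1 * p)^-1 ->
  p <= (1 - expR (- (expR 1 * p))) * expR (- (expR 1 * p)) ^+ d.
Proof.
move=> p0; set e := expR 1; set t := e * p => hd.
have e0 : 0 < e := expR_gt0 1.
have t0 : 0 < t by rewrite mulr_gt0.
have td : t * d%:R <= 1 - t.
  rewrite lerBrDr -[X in _ + X]mulr1 -mulrDr natr1.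
  by rewrite mulrC -ler_pdivlMr // div1r.
have -> : p = t * e^-1 by rewrite mulrC mulKf ?gt_eqF.
have -> : expR (- t) ^+ d = expR (- (t * d%:R)).
  by rewrite -expRM_natl mulrN mulrC.
apply: (@le_trans _ _ ((1 - expR (- t)) * expR (t - 1))); last first.
  apply: ler_wpM2l; last by rewrite ler_expR; lra.
  by rewrite subr_ge0 -expR0 ler_expR; lra.
have -> : (1 - expR (- t)) * expR (t - 1) = (expR t - 1) * e^-1.
  by rewrite expRD expRN expRN -/e; field; rewrite !gt_eqF ?expR_gt0.
by rewrite ler_pM2r ?invr_gt0 //; have := expR_ge1Dx t; lra.
Qed.

Lemma Pr_uniformE (R : realType) (V : finType) (E : pred (assignment V)) :
  Pr_uniform R E = #|[set a | E a]|%:R / #|{: assignment V}|%:R.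
Proof.
rewrite /Pr_uniform (eq_bigr (fun=> #|{: assignment V}|%:R^-1)).
  by rewrite sumr_const -[LHS]mulr_natl cardsE.
by move=> a _; rewrite prodr_const card_ffun card_bool natrX exprVn.
Qed.

Unset Implicit Arguments.
Set Strict Implicit.

Theorem theorem5 (R : realType) (V : finType) (k : nat) (hk : (1 <= k)%N)
    (F : cnf V) (hF : is_ksat k F)
    (hocc : forall v : V,
      (occurrences F v)%:R <= 2 ^+ k / (expR 1 * k%:R) :> R) :
  satisfiable F /\
  expR (- (expR 1 * (size F)%:R * 2 ^- k))
    <= Pr_uniform R (fun a : assignment V => sat_cnf a F).
Proof.
(* A positive lower bound on the probability already yields a satisfying assignment. *)
suff hP : expR (- (expR 1 * (size F)%:R * 2 ^- k))
    <= Pr_uniform R (fun a : assignment V => sat_cnf a F).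
  split=> //; have := lt_le_trans (expR_gt0 _) hP.
  rewrite Pr_uniformE; have [-> |[a]] := set_0Vmem [set a | sat_cnf a F].
    by rewrite cards0 mul0r ltxx.
  by rewrite inE; exists a.
pose p : R := 2 ^- k; pose t := expR 1 * p.
have p0 : 0 < p by rewrite invr_gt0 exprn_gt0.
have t0 : 0 < t by rewrite mulr_gt0 ?expR_gt0.
pose Cl (i : 'I_(size F)) := tnth (in_tuple F) i.
have cardCl i : #|Cl i| = k by have /allP/(_ _ (mem_tnth i (in_tuple F)))/eqP := hF.
pose bad i := [set a : assignment V | ~~ sat_clause a (Cl i)].
pose M i := [set j | ~~ [disjoint clause_vars (Cl i) & clause_vars (Cl j)]].
(* Since [k] is positive, a clause meets itself; removing [i] from [M i] thus gains the 1 in [d.+1]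
   of the weight condition. *)
have iM i : i \in M i.
  rewrite inE -setI_eq0 setIid -card_gt0.
  have /card_gt0P[l lC] : (0 < #|Cl i|)%N by rewrite cardCl.
  by apply/card_gt0P; exists l.1; exact: mem_clause_vars.
(* At most [k] variables, each in at most $2^k/(ek)$ clauses, give $2^k/e = t^{-1}$. *)
have cardM i : #|M i|%:R <= t^-1 :> R.
  apply: (le_trans (y := (\sum_(v in clause_vars (Cl i)) occurrences F v)%:R)).
    by rewrite ler_nat card_meeting_clauses_le.
  rewrite natr_sum; apply: (le_trans (ler_sum _ (fun v _ => hocc v))).
  rewrite sumr_const -[leLHS]mulr_natl.
  have -> : t^-1 = k%:R * (2 ^+ k / (expR 1 * k%:R)) :> R.
    by rewrite /t /p; field; rewrite ?expf_neq0 ?gt_eqF ?expR_gt0 ?ltr0n.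
  rewrite ler_wpM2r ?divr_ge0 ?mulr_ge0 ?exprn_ge0 ?ler0n ?expR_ge0 //.
  by rewrite ler_nat -(cardCl i) clause_varsE leq_imset_card.
have avoidE : avoid bad setT = [set a | sat_cnf a F].
  apply/setP => a; rewrite !inE.
  apply/forall_inP/(@all_tnthP _ _ _ (in_tuple F)) => h i.
    by have := h i (in_setT i); rewrite inE negbK.
  by move=> _; rewrite inE negbK; exact: h.
have := @lopsided_local_lemma R _ _ bad (fun i => M i :\ i) (fun=> 1 - expR (- t)).
rewrite avoidE prodr_const card_ord Pr_uniformE => LLL.
have -> : - (expR 1 * (size F)%:R * 2 ^- k) = (size F)%:R * - t.
  by rewrite /t /p; ring.
have T0 : (0 < #|{: assignment V}|)%N by rewrite card_ffun card_bool expn_gt0.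
rewrite expRM_natl ler_pdivlMr ?ltr0n //.
move: LLL; rewrite subKr; apply=> [i|i S iS dis].
  rewrite subr_ge0 -expR0 ler_expR oppr_le0 ltW //=.
  by rewrite gerBl expR_ge0.
rewrite prodr_const.
apply: (@le_trans _ _ (p * #|avoid bad S|%:R)); last first.
  rewrite ler_wpM2r ?ler0n // local_lemma_weight //.
  by have := cardM i; rewrite (cardsD1 i) iM.
(* The clauses of [S] share no variable with clause [i], so [avoid bad S] does not depend on the
   variables of that clause, which is violated on at most a fraction $2^{-k}$ of it. *)
rewrite mulrC ler_pdivlMr ?exprn_gt0 // -natrX -natrM ler_nat -(cardCl i).
apply: card_unsat_indep => a b ab; rewrite !inE => /forall_inP aS.
apply/forall_inP => j jS; have := aS j jS; rewrite !inE !negbK.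
rewrite (@eq_sat_clause _ a b) // => v vj; apply: ab; rewrite in_setC.
(* [dis] only excludes [j] from [M i :\ i]; as [i] is not in [S], it follows that [j] is not in
   [M i]. *)
have jNi : j != i by apply: contraNneq iS => <-.
have := disjointFr dis jS; rewrite in_setD1 jNi [j \in M i]inE => /negbFE dij.
by rewrite (disjointFl dij vj).
Qed.
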